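(* Let $\mathcal{C}\subseteq\mathbb{R}^n$ be nonempty, compact, convex and $\alpha$-strongly convex with $\alpha>0$, let $F:\mathcal{C}\to\mathbb{R}^n$ be monotone and $C^1$, and let $\{x_k\}_{k\ge 0}$ be a sequence generated by the Frank-Wolfe iteration $$x_{k+1}=x_k+\gamma_{k+1}(s_k-x_k),\qquad s_k\in\operatorname{argmin}_{s\in\mathcal{C}}\langle F(x_k),s\rangle,\qquad x_0\in\mathcal{C},$$ with step sizes $\gamma_k\in(0,1]$ $(k\ge 1)$ satisfying $\gamma_k\to 0$ and $\sum_{k=1}^\infty\gamma_k=\infty$. Let $V(x)=\max_{s\in\mathcal{C}}\langle F(x),x-s\rangle$ for $x\in\mathcal{C}$. Then $F$ is Lipschitz on $\mathcal{C}$ with a constant $L>0$, and for all $k\ge 1$, $$V(x_{k+1})\le\max\big\{(1-\gamma_{k+1})V(x_k)+B\gamma_{k+1}^{3/2},\ C\sqrt{\gamma_{k+1}}\big\},$$ where $B=\frac{2L^2\operatorname{diam}(\mathcal{C})^2}{\alpha}$ and $C=\operatorname{diam}(\mathcal{C})(1+L\operatorname{diam}(\mathcal{C}))$. In particular, if $\gamma_k=1/k$ for all $k\ge 1$, then for all $k\ge 1$, $$V(x_k)\le\frac{A}{\sqrt{k}},\qquad\text{where } A=\max\{V(x_1),2B,C\}.$$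
   Context: $\|\cdot\|$ is the Euclidean norm and $\langle\cdot,\cdot\rangle$ the Euclidean inner product on $\mathbb{R}^n$; $\operatorname{diam}(\mathcal{C})=\max_{x,y\in\mathcal{C}}\|x-y\|$. $F$ is monotone if $\langle F(x)-F(y),x-y\rangle\ge 0$ for all $x,y\in\mathcal{C}$. A nonempty set $\mathcal{C}$ is $\alpha$-strongly convex if for all $x,y\in\mathcal{C}$ and $t\in[0,1]$ one has $B\big((1-t)x+ty,\tfrac{\alpha}{2}t(1-t)\|x-y\|^2\big)\subseteq\mathcal{C}$, where $B(c,r)$ is the closed Euclidean ball with center $c$ and radius $r$ (with $B(c,0)=\{c\}$). At each step $s_k$ is an arbitrary element of the argmin set (which may be non-singleton when $F(x_k)=0$). $V$ is called the Frank-Wolfe gap. The number $B$ in the claim is a constant, not a ball. *)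

(* Defs.v *)
From mathcomp Require Export all_boot all_order all_algebra.
From mathcomp Require Export all_classical all_reals all_analysis.

Set Implicit Arguments.
Unset Strict Implicit.
Unset Printing Implicit Defensive.

Export Order.TTheory GRing.Theory Num.Theory.
Export numFieldNormedType.Exports.

Local Open Scope classical_set_scope.
Local Open Scope ring_scope.

(* The library norm `|x| on 'rV[R]_n is the sup norm: it induces the usual
   topology (used for compactness, continuity and differentiability), but every
   quantitative notion below uses the Euclidean norm [enorm]. *)

Definition dotp (R : realType) (n : nat) (u v : 'rV[R]_n) : R :=
  \sum_(i < n) u ord0 i * v ord0 i.

Definition enorm (R : realType) (n : nat) (u : 'rV[R]_n) : R :=
  Num.sqrt (dotp u u).

Definition eclosed_ball (R : realType) (n : nat) (c : 'rV[R]_n) (r : R) :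
    set 'rV[R]_n :=
  [set z | enorm (z - c) <= r].

(* On a nonempty compact set this supremum is a maximum. *)
Definition ediam (R : realType) (n : nat) (C : set 'rV[R]_n) : R :=
  sup [set enorm (p.1 - p.2) | p in C `*` C].

Definition strongly_convex_set (R : realType) (n : nat) (alpha : R)
    (C : set 'rV[R]_n) : Prop :=
  C !=set0 /\
  forall (x y : 'rV[R]_n) (t : R), C x -> C y -> 0 <= t <= 1 ->
    eclosed_ball ((1 - t) *: x + t *: y)
      (alpha / 2 * t * (1 - t) * enorm (x - y) ^+ 2) `<=` C.

(* A map C -> R^n is represented by a total function; only its values on C
   matter in the definitions below. *)

Definition monotone_on (R : realType) (n : nat) (C : set 'rV[R]_n)
    (F : 'rV[R]_n -> 'rV[R]_n) : Prop :=
  forall x y : 'rV[R]_n, C x -> C y -> 0 <= dotp (F x - F y) (x - y).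

(* C^1 on the (closed) set C: differentiability relative to C, at every point
   of C, with a derivative [dF] that is continuous on C. Vectors are rows, so
   the linear map v |-> DF(x) v is [v *m dF x]. Nothing is required of F or dF
   outside C. *)
Definition C1_on (R : realType) (n : nat) (C : set 'rV[R]_n)
    (F : 'rV[R]_n -> 'rV[R]_n) : Prop :=
  exists dF : 'rV[R]_n -> 'M[R]_n,
    {within C, continuous dF} /\
    forall x : 'rV[R]_n, C x ->
      (fun y : 'rV[R]_n => F y - F x - (y - x) *m dF x)
        =o_ (within C (nbhs x)) (fun y : 'rV[R]_n => y - x).

Definition elipschitz_on (R : realType) (n : nat) (L : R) (C : set 'rV[R]_n)
    (F : 'rV[R]_n -> 'rV[R]_n) : Prop :=
  forall x y : 'rV[R]_n, C x -> C y -> enorm (F x - F y) <= L * enorm (x - y).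

Definition argmin_on (R : realType) (T : Type) (C : set T) (f : T -> R) :
    set T :=
  [set s | C s /\ forall t : T, C t -> f s <= f t].

Definition frank_wolfe (R : realType) (n : nat) (C : set 'rV[R]_n)
    (F : 'rV[R]_n -> 'rV[R]_n) (gamma : nat -> R) (x s : nat -> 'rV[R]_n) :
    Prop :=
  C (x 0%N) /\
  forall k : nat,
    argmin_on C (fun z => dotp (F (x k)) z) (s k) /\
    x k.+1 = x k + gamma k.+1 *: (s k - x k).

(* On a nonempty compact set this supremum is a maximum. *)
Definition fw_gap (R : realType) (n : nat) (C : set 'rV[R]_n)
    (F : 'rV[R]_n -> 'rV[R]_n) (x : 'rV[R]_n) : R :=
  sup [set dotp (F x) (x - s) | s in C].

(* Main.v *)
Require Import Defs.
From mathcomp Require Import all_boot all_order all_algebra.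
From mathcomp Require Import all_classical all_reals all_analysis.
From mathcomp Require Import ring lra.

(** Write [x], [y = x + gamma (s - x)] for two consecutive iterates and [s],
    [s'] for the corresponding minimizers. At a minimizer the supremum defining
    the gap is attained ([fw_gap_argmin]), and
      [V(y) = <F y, y - s'> = (1 - gamma) <F y, x - s> + <F y, s - s'>].
    Since [y - x] is a positive multiple of [s - x], monotonicity of [F] between
    [x] and [y] bounds the first term by [(1 - gamma) V(x)]. In the second term
    [F y] may be replaced by [F y - F x], because [s] minimizes [<F x, .>]; its
    size is then at most [L gamma D |s - s'|], and everything rests on how much
    the minimizer can move.

    Strong convexity controls this: [C] contains a ball around each interior
    point of the chord from [s] to [s'], so the linear form [<g, .>] exceeds its
    minimum over [C] by an amount quadratic in [|s - s'|]
    ([strongly_convex_argmin]); hence [|s - s'|] is at most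
    [2 |F y - F x| / (alpha |F x|)] ([argmin_dist_le]). This is useful only
    if [F x] is not too small, whence the maximum in the statement: the cut is
    made at [|F x| = sqrt gamma]. Above it, [|s - s'|] is of order
    [sqrt gamma] and the error is [B gamma^(3/2)]; below it, [F y] itself is of
    order [sqrt gamma], and so is [V(y)], which is at most [D |F y|]. This is
    [fw_gap_step].

    For [gamma_k = 1/k] the recursion is solved by induction
    ([fw_recursion_rate]); the inductive step amounts to
    [sqrt (k (k+1)) <= k + 1/2].

    That [F] is Lipschitz is the mean value theorem along the segments of [C],
    applied to each coordinate, with the derivative bounded by compactness
    ([convex_C1_lipschitz]). *)

Set Implicit Arguments.
Unset Strict Implicit.
Unset Printing Implicit Defensive.

Local Open Scope classical_set_scope.
Local Open Scope ring_scope.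

(** * Euclidean inner product and norm *)

Section Euclidean.
Context {R : realType} {n : nat}.
Implicit Types u v w : 'rV[R]_n.

Lemma dotpC u v : dotp u v = dotp v u.
Proof. by apply: eq_bigr => i _; rewrite mulrC. Qed.

Lemma dotpDr u v w : dotp u (v + w) = dotp u v + dotp u w.
Proof. by rewrite -big_split; apply: eq_bigr => i _; rewrite mxE mulrDr. Qed.

Lemma dotpZr a u v : dotp u (a *: v) = a * dotp u v.
Proof. by rewrite mulr_sumr; apply: eq_bigr => i _; rewrite mxE mulrCA. Qed.

Lemma dotpNr u v : dotp u (- v) = - dotp u v.
Proof. by rewrite -scaleN1r dotpZr mulN1r. Qed.

Lemma dotpBr u v w : dotp u (v - w) = dotp u v - dotp u w.
Proof. by rewrite dotpDr dotpNr. Qed.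

Lemma dotpBl u v w : dotp (u - v) w = dotp u w - dotp v w.
Proof. by rewrite dotpC dotpBr !(dotpC w). Qed.

Lemma dotp_ge0 u : 0 <= dotp u u.
Proof. by apply: sumr_ge0 => i _; rewrite -expr2 sqr_ge0. Qed.

Lemma enorm_ge0 u : 0 <= enorm u. Proof. exact: sqrtr_ge0. Qed.

Lemma sqr_enorm u : enorm u ^+ 2 = dotp u u.
Proof. by rewrite sqr_sqrtr // dotp_ge0. Qed.

Lemma enormN u : enorm (- u) = enorm u.
Proof. by rewrite /enorm dotpNr dotpC dotpNr opprK. Qed.

Lemma enormB u v : enorm (u - v) = enorm (v - u).
Proof. by rewrite -enormN opprB. Qed.

Lemma enormZ a u : enorm (a *: u) = `|a| * enorm u.
Proof.
by rewrite /enorm dotpZr dotpC dotpZr mulrA -expr2 sqrtrM ?sqr_ge0// sqrtr_sqr.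
Qed.

Lemma ler_norm_enorm u i : `|u ord0 i| <= enorm u.
Proof.
rewrite -sqrtr_sqr ler_wsqrtr // /dotp (bigD1 i) //= -expr2 lerDl.
by apply: sumr_ge0 => j _; rewrite -expr2 sqr_ge0.
Qed.

Lemma enorm_eq0 u : enorm u = 0 -> u = 0.
Proof.
move=> u0; apply/rowP => i; rewrite mxE; apply/eqP; rewrite -normr_le0.
by rewrite -u0 ler_norm_enorm.
Qed.

(** Together with [ler_norm_enorm], the comparison with the sup norm, which
    carries the topology. *)
Lemma enorm_le_entries u (N : R) :
  0 <= N -> (forall i, `|u ord0 i| <= N) -> enorm u <= Num.sqrt n%:R * N.
Proof.
move=> N0 uN; have -> : Num.sqrt n%:R * N = Num.sqrt (n%:R * N ^+ 2).
  by rewrite sqrtrM ?ler0n // sqrtr_sqr ger0_norm.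
rewrite ler_wsqrtr // mulr_natl -[n in leRHS]card_ord -sumr_const.
apply: ler_sum => i _.
by rewrite -expr2 -real_normK ?num_real // lerXn2r ?nnegrE.
Qed.

(** Expanding [0 <= | |v|^2 u - <u, v> v |^2] gives
    [|v|^2 ((|u| |v|)^2 - <u, v>^2)]. *)
Lemma CauchySchwarz_dotp u v : dotp u v <= enorm u * enorm v.
Proof.
have [v0|v_gt0] : enorm v = 0 \/ 0 < enorm v.
- by have := enorm_ge0 v; rewrite le_eqVlt => /predU1P[]; [left|right].
- by rewrite v0 mulr0 (enorm_eq0 v0) -(subrr 0) dotpBr subrr.
have := dotp_ge0 (enorm v ^+ 2 *: u - dotp u v *: v).
rewrite dotpBr !dotpBl !dotpZr !(dotpC (_ *: _)) !dotpZr -!sqr_enorm (dotpC v u).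
set p := enorm u; set q := enorm v; set r := dotp u v => H.
have {}H : 0 <= q ^+ 2 * ((p * q) ^+ 2 - r ^+ 2) by apply: le_trans H _; lra.
move: H; rewrite pmulr_rge0 ?exprn_gt0 // subr_ge0 => H.
apply: le_trans (ler_norm r) _.
by rewrite -ler_sqr ?nnegrE ?mulr_ge0 ?enorm_ge0 // real_normK ?num_real.
Qed.

Lemma ler_enormD u v : enorm (u + v) <= enorm u + enorm v.
Proof.
rewrite -ler_sqr ?nnegrE ?addr_ge0 ?enorm_ge0 // sqrrD !sqr_enorm.
rewrite dotpDr !(dotpC (u + v)) !dotpDr (dotpC v u).
by have := CauchySchwarz_dotp u v; lra.
Qed.

End Euclidean.

(** * Continuously differentiable maps on a compact convex set are Lipschitz *)

Lemma entry_le_mx_norm {R : realType} m p (M : 'M[R]_(m, p)) i j : `|M i j| <= `|M|.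
Proof.
rewrite /Num.norm/= mx_normrE.
exact: (le_bigmax _ (fun ij : 'I_m * 'I_p => `|M ij.1 ij.2|) (i, j)).
Qed.

Lemma mx_row_entry_le (R : realType) (n : nat) (v : 'rV[R]_n) (M : 'M[R]_n)
    (a b : R) i :
  (forall j, `|v ord0 j| <= a) -> (forall j k, `|M j k| <= b) ->
  `|(v *m M) ord0 i| <= n%:R * (a * b).
Proof.
move=> va Mb; rewrite mxE (le_trans (ler_norm_sum _ _ _)) //.
rewrite mulr_natl -[n in leRHS]card_ord -sumr_const.
by apply: ler_sum => j _; rewrite normrM ler_pM.
Qed.

Lemma is_derive_first_order (R : realType) (g : R -> R) (t d : R) :
  (forall e : R, 0 < e ->
     \forall u \near t, `|g u - g t - (u - t) * d| <= e * `|u - t|) ->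
  is_derive t 1 g d.
Proof.
move=> gd.
suff cd : (h^-1 *: ((g \o shift t) (h *: 1) - g t)) @[h --> 0^'] --> d.
  by apply: DeriveDef; [apply: cvgP cd|apply: cvg_lim cd].
apply/cvgrPdist_le => e e0.
have /nbhs_ballP[r /= r0 rgd] := gd e e0.
near=> h.
have h0 : h != 0 by near: h; exact: nbhs_dnbhs_neq.
have : ball t r (h *: 1 + t).
  rewrite /ball /= /shift /= opprD addrCA subrr addr0 normrN /GRing.scale /= mulr1.
  by near: h; exact: dnbhs0_lt.
move=> /rgd /=; rewrite /GRing.scale /= mulr1 addrK => H.
have -> : d - h^-1 * (g (h + t) - g t) = - (h^-1 * (g (h + t) - g t - h * d)).
  by field.
rewrite normrN normrM normfV ler_pdivrMl ?normr_gt0 //.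
by rewrite [leRHS]mulrC.
Unshelve. all: by end_near. Qed.

(** A mean value inequality for a function on [[0, 1]] that need not be
    differentiable, nor even continuous, as a function on the whole line: at the
    endpoints the expansion is one-sided. This is what a map differentiable only
    relative to [C] provides along a segment of [C]. *)
Lemma segment_mean_value (R : realType) (g d : R -> R) (K : R) :
  (forall t : R, 0 <= t <= 1 -> `|d t| <= K) ->
  (forall t : R, 0 <= t <= 1 -> forall e : R, 0 < e ->
     \forall u \near t,
       0 <= u <= 1 -> `|g u - g t - (u - t) * d t| <= e * `|u - t|) ->
  `|g 1 - g 0| <= K.
Proof.
move=> dK gd.
have gder (t : R) : t \in `]0, 1[ -> is_derive t 1 g (d t).
  move=> t01; apply: is_derive_first_order => e e0.
  have := near_in_itvoo t01; rewrite in_itv /= in t01.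
  case/andP: t01 => t0 t1 nt.
  have {}gd : \forall u \near t,
      0 <= u <= 1 -> `|g u - g t - (u - t) * d t| <= e * `|u - t|.
    by apply: gd; rewrite ?ltW.
  near=> u.
  suff u01 : 0 <= u <= 1 by move: u01; near: u.
  have : u \in `]0, 1[ by near: u.
  by rewrite in_itv /= => /andP[u0 u1]; rewrite !ltW.
have gcont : {within `[0, 1], continuous g}.
  apply/subspace_continuousP => t; rewrite /= in_itv /= => t01.
  apply/cvgrPdist_le => e e0.
  have Kd := dK _ t01.
  have K0 : 0 <= K := le_trans (normr_ge0 _) Kd.
  have gdt := gd t t01 1 ltr01.
  (* Near [t], [|g u - g t| <= (1 + K) |u - t|]. *)
  have eK0 : 0 < e / (1 + K) by rewrite divr_gt0 // ltr_pwDl.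
  have near_t : \forall u \near t, `|t - u| <= e / (1 + K).
    exact: cvgr_dist_le (@cvg_id _ (nbhs t)) _ eK0.
  rewrite near_withinE; near=> u; rewrite /= in_itv /= => u01.
  have H : `|g u - g t - (u - t) * d t| <= 1 * `|u - t| by move: u01; near: u.
  have tu : `|t - u| <= e / (1 + K) by near: u.
  rewrite distrC -[_ - _](subrK ((u - t) * d t)).
  rewrite (le_trans (ler_normD _ _)) // normrM.
  rewrite distrC ler_pdivlMr ?ltr_wpDr // in tu.
  have : `|u - t| * `|d t| <= `|u - t| * K by rewrite ler_wpM2l.
  by lra.
have [c c01 ->] := MVT ltr01 gder gcont.
rewrite subr0 mulr1; apply: dK; move: c01; rewrite in_itv /= => /andP[c0 c1].
by rewrite !ltW.
Unshelve. all: by end_near. Qed.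

Lemma convex_C1_lipschitz (R : realType) (n : nat) (C : set 'rV[R]_n) F :
  compact C ->
  (forall x y t, C x -> C y -> 0 <= t <= 1 -> C (x + t *: (y - x))) ->
  C1_on C F -> exists2 L : R, 0 < L & elipschitz_on L C F.
Proof.
move=> Ccpt Cconv [dF [dFc dFo]].
have [N [_ /(_ (`|N| + 1))]] := compact_bounded (continuous_compact dFc Ccpt).
rewrite ltr_pwDr // ?ler_norm // => /(_ isT) dFN.
set M := `|N| + 1 in dFN.
have M0 : 0 <= M by rewrite addr_ge0.
have {}dFN z j k : C z -> `|dF z j k| <= M.
  move=> Cz; apply: le_trans (entry_le_mx_norm _ _ _) _.
  by apply: dFN; exists z.
pose K := Num.sqrt n%:R * (n%:R * M).
have K0 : 0 <= K by rewrite !mulr_ge0.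
(* The summand [1] makes the constant positive even if [K = 0]. *)
exists (K + 1) => [|x y Cx Cy]; first by rewrite ltr_wpDl.
rewrite enormB (enormB x).
apply: le_trans (_ : _ <= K * enorm (y - x)) _; last first.
  by rewrite ler_wpM2r ?enorm_ge0 // lerDl.
rewrite -mulrA; apply: enorm_le_entries => [|i].
  by rewrite !mulr_ge0 ?enorm_ge0.
pose p t := x + t *: (y - x).
have Cp t : 0 <= t <= 1 -> C (p t) by apply: Cconv.
have pB t u : p u - p t = (u - t) *: (y - x).
  by apply/rowP => j; rewrite !mxE; ring.
have pc : continuous p.
  move=> t; apply: cvgD; first exact: cvg_cst.
  by apply: cvgZl; exact: cvg_id.
have := @segment_mean_value R (fun t => F (p t) ord0 i)
  (fun t => ((y - x) *m dF (p t)) ord0 i) (n%:R * M * enorm (y - x)).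
have -> : p 0 = x by rewrite /p scale0r addr0.
have -> : p 1 = y by rewrite /p scale1r subrKC.
rewrite !mxE; apply => [t t01|t t01 e e0].
  rewrite -mulrA (mulrC M); apply: mx_row_entry_le => [j|j k].
    exact: ler_norm_enorm.
  by apply: dFN; exact: Cp.
have /eqoP := dFo _ (Cp _ t01).
(* [|p u - p t| = |u - t| |y - x|]; the summand [1] covers [x = y]. *)
have e'0 : 0 < e / (1 + `|y - x|) by rewrite divr_gt0 // ltr_pwDl.
move=> /(_ _ e'0) /pc.
rewrite /= => Ho.
near=> u => u01.
have : `|F (p u) - F (p t) - (p u - p t) *m dF (p t)| <=
    e / (1 + `|y - x|) * `|p u - p t|.
  by move: (Cp _ u01); near: u; exact: Ho.
rewrite pB -scalemxAl normrZ => H.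
have := le_trans (entry_le_mx_norm _ ord0 i) H.
rewrite !mxE => /le_trans; apply.
rewrite mulrCA [leRHS]mulrC ler_wpM2l // mulrAC ler_pdivrMr ?ltr_pwDl //.
by rewrite ler_pM2l // lerDr.
Unshelve. all: by end_near. Qed.

(** * Minimizing linear forms over a strongly convex set *)

Lemma strongly_convex_segment (R : realType) (n : nat) (C : set 'rV[R]_n)
    (alpha : R) (x y : 'rV[R]_n) (t : R) :
  0 <= alpha -> strongly_convex_set alpha C -> C x -> C y -> 0 <= t <= 1 ->
  C (x + t *: (y - x)).
Proof.
move=> alpha0 [_ scC] Cx Cy t01; apply: (scC x y t Cx Cy t01).
have -> : x + t *: (y - x) = (1 - t) *: x + t *: y.
  by apply/rowP => i; rewrite !mxE; ring.
case/andP: t01 => t0 t1; rewrite /eclosed_ball /= subrr.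
rewrite /enorm {1}/dotp big1 => [|i _]; last by rewrite mxE mul0r.
rewrite sqrtr0 mulr_ge0 ?sqr_ge0 // mulr_ge0 ?subr_ge0 // mulr_ge0 //.
by rewrite divr_ge0.
Qed.

(** Quadratic growth of a linear form away from its minimizer. The factor
    [alpha / 2] is what remains of the radius [alpha / 2 * t * (1 - t)] after
    division by [t], as [t] tends to [0]. *)
Lemma strongly_convex_argmin (R : realType) (n : nat) (C : set 'rV[R]_n) (alpha : R)
    (g s s' : 'rV[R]_n) :
  0 <= alpha -> strongly_convex_set alpha C ->
  argmin_on C (dotp g) s -> C s' ->
  alpha / 2 * enorm (s - s') ^+ 2 * enorm g <= dotp g (s' - s).
Proof.
move=> alpha0 [_ scC] [Cs smin] Cs'; set b := dotp g _; set w := leLHS.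
have b0 : 0 <= b by rewrite /b dotpBr subr_ge0 smin.
have w0 : 0 <= w by rewrite /w !mulr_ge0 ?exprn_ge0 ?enorm_ge0 // ?invr_ge0.
(* Moving from the point at parameter [t] of the chord straight down along
   [- g] to the boundary of its ball gives a competitor for [s]. *)
have wb t : 0 < t -> t < 1 -> w * (1 - t) <= b.
  move=> t0 t1; have [g0|g0] := eqVneq (enorm g) 0.
    by rewrite /w g0 mulr0 mul0r.
  have g_gt0 : 0 < enorm g by rewrite lt_def g0 enorm_ge0.
  pose r := alpha / 2 * t * (1 - t) * enorm (s - s') ^+ 2.
  have r0 : 0 <= r.
    by rewrite /r !mulr_ge0 ?subr_ge0 ?exprn_ge0 ?enorm_ge0 // ?invr_ge0 // ltW.
  pose z := (1 - t) *: s + t *: s' - (r / enorm g) *: g.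
  have Cz : C z.
    apply: (scC s s' t) => //; first by rewrite !ltW.
    rewrite /eclosed_ball /= /z addrC addKr enormN enormZ.
    by rewrite ger0_norm ?divr_ge0 ?enorm_ge0 // divfK.
  have := smin _ Cz.
  rewrite /z dotpBr dotpDr !dotpZr -sqr_enorm expr2 mulrA divfK // => H.
  have {}H : r * enorm g <= t * b by rewrite /b dotpBr; lra.
  rewrite -(ler_pM2l t0); apply: le_trans H.
  by rewrite /r /w; lra.
(* Let [t] tend to [0]; if [b < w], the [t] with
   [w (1 - t) = (w + b) / 2] is already a contradiction. *)
clearbody w b; rewrite leNgt; apply/negP => bw.
have w_gt0 : 0 < w by apply: le_lt_trans bw.
have := wb ((w - b) / (2 * w)).
have -> : w * (1 - (w - b) / (2 * w)) = (w + b) / 2 by field; rewrite gt_eqF.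
rewrite divr_gt0 ?subr_gt0 ?mulr_gt0 // => /(_ isT).
rewrite ltr_pdivrMr ?mulr_gt0 // => H.
have /H : w - b < 1 * (2 * w) by lra.
lra.
Qed.

(** Stability of minimizers under a change of the linear form: the quadratic
    growth of [<g, .>] is paid for by [<g' - g, s - s'>], since [s'] is optimal
    for [g']. Stated without division, so that [g = 0] is allowed. *)
Lemma argmin_dist_le (R : realType) (n : nat) (C : set 'rV[R]_n) (alpha : R)
    (g g' s s' : 'rV[R]_n) :
  0 < alpha -> strongly_convex_set alpha C ->
  argmin_on C (dotp g) s -> argmin_on C (dotp g') s' ->
  alpha / 2 * enorm g * enorm (s - s') <= enorm (g' - g).
Proof.
move=> alpha0 scC gs gs'.
have H1 := strongly_convex_argmin (ltW alpha0) scC gs gs'.1.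
have H2 : 0 <= dotp g' (s - s') by rewrite dotpBr subr_ge0 gs'.2 //; case: gs.
have CS := CauchySchwarz_dotp (g' - g) (s - s').
have [s0|s_neq0] := eqVneq (enorm (s - s')) 0.
  by rewrite s0 mulr0 enorm_ge0.
have s_gt0 : 0 < enorm (s - s') by rewrite lt_def s_neq0 enorm_ge0.
rewrite -(ler_pM2r s_gt0); apply: le_trans CS.
rewrite dotpBl; move: H1 H2; rewrite !dotpBr; lra.
Qed.

(** * Decrease of the Frank-Wolfe gap *)

Lemma le_ediam (R : realType) (n : nat) (C : set 'rV[R]_n) (x y : 'rV[R]_n) :
  compact C -> C x -> C y -> enorm (x - y) <= ediam C.
Proof.
move=> /compact_bounded[N [_ /(_ (`|N| + 1))]] CN Cx Cy.
have {}CN z : C z -> `|z| <= `|N| + 1.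
  by move=> Cz; apply: CN => //; rewrite (le_lt_trans (ler_norm N)) // ltrDl.
apply: ub_le_sup; last by exists (x, y).
exists (Num.sqrt n%:R * ((`|N| + 1) + (`|N| + 1))) => _ [[a b] /= [Ca Cb] <-].
apply: enorm_le_entries => [|i]; first by rewrite ?addr_ge0.
rewrite !mxE (le_trans (ler_normB _ _)) // lerD //.
- by apply: le_trans (CN _ Ca); apply: entry_le_mx_norm.
- by apply: le_trans (CN _ Cb); apply: entry_le_mx_norm.
Qed.

Lemma fw_gap_argmin (R : realType) (n : nat) (C : set 'rV[R]_n) F (x s : 'rV[R]_n) :
  argmin_on C (fun z => dotp (F x) z) s -> fw_gap C F x = dotp (F x) (x - s).
Proof.
move=> [Cs smin]; set A := [set dotp (F x) (x - z) | z in C].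
have ubA : ubound A (dotp (F x) (x - s)).
  by move=> _ [z Cz <-]; rewrite !dotpBr lerD2l lerN2 smin.
apply/eqP; rewrite eq_le; apply/andP; split.
  by apply: ge_sup => //; exists (dotp (F x) (x - s)), s.
by apply: ub_le_sup; [exists (dotp (F x) (x - s))|exists s].
Qed.

Lemma fw_gap_step (R : realType) (n : nat) (C : set 'rV[R]_n) F
    (alpha L gamma : R) (x s s' : 'rV[R]_n) :
  let y := x + gamma *: (s - x) in
  let D := ediam C in
  compact C -> 0 < alpha -> strongly_convex_set alpha C ->
  monotone_on C F -> 0 < L -> elipschitz_on L C F -> 0 < gamma <= 1 ->
  C x -> C y ->
  argmin_on C (fun z => dotp (F x) z) s ->
  argmin_on C (fun z => dotp (F y) z) s' ->
  fw_gap C F y <=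
    Num.max ((1 - gamma) * fw_gap C F x +
               2 * L ^+ 2 * D ^+ 2 / alpha * (gamma `^ (3 / 2)))
            (D * (1 + L * D) * Num.sqrt gamma).
Proof.
move=> y D Ccpt alpha0 scC Fm L0 FL /andP[g0 g1] Cx Cy xs ys'.
have [Cs smin] := xs; have [Cs' smin'] := ys'.
rewrite (fw_gap_argmin xs) (fw_gap_argmin ys').
have D0 : 0 <= D by apply: le_trans (le_ediam Ccpt Cx Cx); rewrite enorm_ge0.
have yx : y - x = gamma *: (s - x) by rewrite /y addrC addKr.
have dF : enorm (F y - F x) <= L * gamma * D.
  apply: le_trans (FL _ _ Cy Cx) _; rewrite -mulrA ler_pM2l //.
  rewrite yx enormZ gtr0_norm // ler_pM2l //.
  exact: le_ediam.
have q0 : 0 < Num.sqrt gamma by rewrite sqrtr_gt0.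
have q2 : Num.sqrt gamma ^+ 2 = gamma by rewrite sqr_sqrtr // ltW.
have q1 : Num.sqrt gamma <= 1 by rewrite -sqrtr1 ler_wsqrtr.
have -> : gamma `^ (3 / 2) = Num.sqrt gamma ^+ 3.
  by rewrite mulrC powRrM powR12_sqrt ?ltW // powR_mulrn // ltW.
move: q0 q2 q1; set q := Num.sqrt gamma => q0 q2 q1.
(* Everything is polynomial in [q = sqrt gamma], and [q <= 1]. *)
rewrite le_max; apply/orP; have [Fx|Fx] := lerP (enorm (F x)) q; [right|left].
- have Fy : enorm (F y) <= q * (1 + L * D).
    have : enorm (F y) <= enorm (F x) + enorm (F y - F x).
      by rewrite -{1}(subrKC (F x) (F y)) ler_enormD.
    have : L * gamma * D <= q * (L * D).
      rewrite -q2 expr2 mulrAC mulrC -mulrA ler_pM2l // ler_piMl //.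
      by rewrite mulr_ge0 // ltW.
    by lra.
  apply: le_trans (CauchySchwarz_dotp _ _) _.
  rewrite -mulrA mulrC; apply: ler_pM; rewrite ?enorm_ge0 //.
    exact: le_ediam.
  by rewrite mulrC.
have ss' := argmin_dist_le alpha0 scC xs ys'.
have sxs : enorm (s - s') <= 2 * L * q * D / alpha.
  rewrite ler_pdivlMr //.
  (* A factor [q] cancels: [|F x|] is bounded below by [q], and
     [gamma = q ^ 2]. *)
  have H : q * (alpha / 2 * enorm (s - s')) <= q * (L * q * D).
    apply: le_trans (_ : _ <= enorm (F x) * (alpha / 2 * enorm (s - s'))) _.
      by rewrite ler_wpM2r ?(ltW Fx) // !mulr_ge0 ?enorm_ge0 // ?invr_ge0 ltW.
    apply: le_trans (_ : enorm (F y - F x) <= _); first by lra.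
    by apply: le_trans dF _; rewrite -q2; lra.
  by move: H; rewrite ler_pM2l //; lra.
have -> : y - s' = (1 - gamma) *: (x - s) + (s - s').
  by apply/rowP => i; rewrite !mxE; ring.
rewrite (dotpDr (F y)) dotpZr; apply: lerD.
- rewrite ler_wpM2l ?subr_ge0 //.
  have := Fm _ _ Cy Cx; rewrite yx dotpZr pmulr_rge0 //.
  by rewrite !dotpBl !dotpBr; lra.
- have -> : dotp (F y) (s - s') =
      dotp (F y - F x) (s - s') + dotp (F x) (s - s').
    by rewrite dotpBl subrK.
  have : dotp (F x) (s - s') <= 0 by rewrite dotpBr subr_le0 smin.
  have := CauchySchwarz_dotp (F y - F x) (s - s').
  have := ler_pM (enorm_ge0 _) (enorm_ge0 _) dF sxs.
  have -> : L * gamma * D * (2 * L * q * D / alpha) =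
      2 * L ^+ 2 * D ^+ 2 / alpha * q ^+ 3.
    by rewrite -q2; field; rewrite gt_eqF.
  by lra.
Qed.

(** The case [gamma_k = 1/k]. The bound [2 * B <= A] leaves room for the error
    term: in the inductive step it is absorbed by the gain [A / 2] in
    [A * sqrt (k * (k + 1)) <= A * (k + 1 - 1 / 2)]. *)
Lemma fw_recursion_rate (R : realType) (V : nat -> R) (B K A : R) :
  0 <= A -> V 1%N <= A -> 2 * B <= A -> K <= A ->
  (forall k : nat, (1 <= k)%N ->
     V k.+1 <= Num.max ((1 - k.+1%:R^-1) * V k + B * (k.+1%:R^-1 `^ (3 / 2)))
                       (K * Num.sqrt (k.+1%:R^-1))) ->
  forall k, (1 <= k)%N -> V k <= A / Num.sqrt k%:R.
Proof.
move=> A0 V1A BA KA rec.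
elim=> // k IH _; have [->|k_gt0] := posnP k.
  by rewrite sqrtr1 divr1.
have {}IH := IH k_gt0.
apply: le_trans (rec _ k_gt0) _.
have -> : k.+1%:R^-1 `^ (3 / 2) = Num.sqrt (k.+1%:R^-1) ^+ 3 :> R.
  by rewrite mulrC powRrM powR12_sqrt ?invr_ge0 // powR_mulrn.
rewrite sqrtrV //.
have -> : k.+1%:R^-1 = (Num.sqrt k.+1%:R)^-1 ^+ 2 :> R.
  by rewrite exprVn sqr_sqrtr.
rewrite ge_max; apply/andP; split; last by rewrite ler_wpM2r // invr_ge0.
have a0 : 0 < Num.sqrt k%:R :> R by rewrite sqrtr_gt0 ltr0n.
have b0 : 0 < Num.sqrt k.+1%:R :> R by rewrite sqrtr_gt0 ltr0n.
have ab : Num.sqrt k.+1%:R ^+ 2 = Num.sqrt k%:R ^+ 2 + 1 :> R.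
  by rewrite !sqr_sqrtr // -natr1.
move: a0 b0 ab IH; set a := Num.sqrt k%:R; set b := Num.sqrt _ => a0 b0 ab IH.
have sb : 1 - b^-1 ^+ 2 = a ^+ 2 / b ^+ 2.
  have -> : a ^+ 2 = b ^+ 2 - 1 by rewrite ab addrK.
  by field; rewrite gt_eqF.
apply: le_trans (_ : _ <= a ^+ 2 / b ^+ 2 * (A / a) + B * b^-1 ^+ 3) _.
  by rewrite sb lerD2r ler_wpM2l // divr_ge0 // sqr_ge0.
have -> : a ^+ 2 / b ^+ 2 * (A / a) + B * b^-1 ^+ 3 = (A * (a * b) + B) / b ^+ 3.
  by field; rewrite !gt_eqF.
have -> : A / b = (A * b ^+ 2) / b ^+ 3 by field; rewrite gt_eqF.
rewrite ler_pM2r ?invr_gt0 ?exprn_gt0 //.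
have : A * (a * b) <= A * (b ^+ 2 - 1 / 2).
  rewrite ler_wpM2l //.
  by have := sqr_ge0 (a - b); rewrite sqrrB; lra.
by lra.
Qed.

Theorem theorem13 (R : realType) (n : nat) (C : set 'rV[R]_n) (alpha : R)
    (F : 'rV[R]_n -> 'rV[R]_n) (gamma : nat -> R) (x s : nat -> 'rV[R]_n)
    (C_nonempty : C !=set0) (C_compact : compact C) (C_convex : convex_set C)
    (alpha_gt0 : 0 < alpha) (C_sconvex : strongly_convex_set alpha C)
    (F_monotone : monotone_on C F) (F_C1 : C1_on C F)
    (gamma_itv : forall k : nat, (1 <= k)%N -> 0 < gamma k <= 1)
    (gamma_to0 : gamma @ \oo --> (0 : R))
    (gamma_sum : (fun N : nat => \sum_(1 <= k < N) gamma k) @ \oo --> +oo)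
    (x_FW : frank_wolfe C F gamma x s) :
  (exists2 L : R, 0 < L & elipschitz_on L C F) /\
  forall L : R, 0 < L -> elipschitz_on L C F ->
    let V := fw_gap C F in
    let D := ediam C in
    let cB := 2 * L ^+ 2 * D ^+ 2 / alpha in
    let cC := D * (1 + L * D) in
    (forall k : nat, (1 <= k)%N ->
       V (x k.+1) <=
         Num.max ((1 - gamma k.+1) * V (x k) + cB * (gamma k.+1 `^ (3 / 2)))
                 (cC * Num.sqrt (gamma k.+1))) /\
    ((forall k : nat, (1 <= k)%N -> gamma k = k%:R^-1) ->
     let cA := Num.max (V (x 1%N)) (Num.max (2 * cB) cC) in
     forall k : nat, (1 <= k)%N -> V (x k) <= cA / Num.sqrt k%:R).
Proof.
have alpha0 := ltW alpha_gt0.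
have C_segment y z t := @strongly_convex_segment _ _ C alpha y z t alpha0 C_sconvex.
split; first exact: convex_C1_lipschitz.
move=> L L_gt0 F_lip V D cB cC.
have [Cx0 FW] := x_FW.
have Cx k : C (x k).
  elim: k => // k Cxk; have [[Csk _] ->] := FW k; apply: C_segment => //.
  by have /andP[/ltW -> ->] := gamma_itv k.+1 isT.
have step k : V (x k.+1) <=
    Num.max ((1 - gamma k.+1) * V (x k) + cB * (gamma k.+1 `^ (3 / 2)))
            (cC * Num.sqrt (gamma k.+1)).
  have [sk xk] := FW k; have [sk1 _] := FW k.+1.
  have := Cx k.+1; move: sk1; rewrite /V xk => sk1 Cxk1.
  exact: (fw_gap_step C_compact alpha_gt0 C_sconvex F_monotone L_gt0 F_lip
    (gamma_itv k.+1 isT) (Cx k) Cxk1 sk sk1).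
split=> // gammaE cA; have cB0 : 0 <= cB.
  by rewrite /cB divr_ge0 // mulr_ge0 ?sqr_ge0 // mulr_ge0 ?sqr_ge0.
have cBA : 2 * cB <= cA by rewrite /cA !le_max lexx orbT.
apply: (@fw_recursion_rate _ (fun k => V (x k)) cB cC) => //.
- by apply: le_trans cBA; rewrite mulr_ge0.
- by rewrite /cA le_max lexx.
- by rewrite /cA !le_max lexx !orbT.
- by move=> k _; rewrite -gammaE.
Qed.
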